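(* Let $H$ be a complex Hilbert space and let $T\in B(H)$ be normal, with Cartesian decomposition $T=A+iB$ ($A,B\in B(H)$ self-adjoint), and such that $\sigma(T)\subset\mathbb{R}$. Then $T$ is self-adjoint.
   Context: $B(H)$ denotes the algebra of all bounded linear operators on $H$, and $\sigma(T)$ is the spectrum of $T$. *)

(* Defs.v *)
From HB Require Import structures.
From mathcomp Require Import all_boot all_order all_algebra.
From mathcomp Require Import sesquilinear complex ring lra.
From mathcomp Require Import boolp classical_sets reals topology normedtype.

Set Implicit Arguments.
Unset Strict Implicit.
Unset Printing Implicit Defensive.

Import Order.TTheory GRing.Theory Num.Theory.
Import numFieldNormedType.Exports.

Local Open Scope classical_set_scope.
Local Open Scope ring_scope.

(* The inner product is linear in its first argument and conjugate-linear in
   the second one. *)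
HB.mixin Record NormedModule_isHilbert (R : realType) H
    & CompleteNormedModule R[i] H := {
  inner : {dot H for @Num.conj R[i]} ;
  normr_inner : forall x : H, `|x| ^+ 2 = inner x x
}.

#[short(type="hilbertType")]
HB.structure Definition Hilbert (R : realType) :=
  {H of CompleteNormedModule R[i] H & NormedModule_isHilbert R H}.

Local Notation "''[' x , y ]" := (inner x%R y%R) : ring_scope.

HB.mixin Record isBoundedOp (R : realType) (H : hilbertType R) (T : H -> H) := {
  op_bounded : exists M : R, forall x, `|T x| <= M%:C%C * `|x|
}.

#[short(type="boundedOp")]
HB.structure Definition BoundedOp (R : realType) (H : hilbertType R) :=
  {T of @GRing.Linear R[i] H H *:%R T & isBoundedOp R H T}.

Section InnerTheory.
Context {R : realType} {H : hilbertType R}.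
Implicit Types (x y z w : H) (a : R[i]) (t : R).

Lemma innerDl x y z : '[x + y, z] = '[x, z] + '[y, z].
Proof. exact: linearDl. Qed.
Lemma innerDr x y z : '[z, x + y] = '[z, x] + '[z, y].
Proof. exact: linearDr. Qed.
Lemma innerZl a x y : '[a *: x, y] = a * '[x, y].
Proof. exact: linearZl_LR. Qed.
Lemma innerZr a x y : '[x, a *: y] = a^* * '[x, y].
Proof. by rewrite linearZr_LR. Qed.
Lemma innerC x y : '[x, y] = '[y, x]^*.
Proof. by rewrite hermC expr0 mul1r. Qed.

Lemma inner_ext x y : (forall w, '[w, x] = '[w, y]) -> x = y.
Proof.
move=> xy; apply/eqP; rewrite -subr_eq0 -(dnorm_eq0 inner).
by rewrite linearBr/= xy subrr.
Qed.

Lemma norm_inner x y : `|'[x, y]| <= `|x| * `|y|.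
Proof.
rewrite -ler_sqr ?nnegrE ?mulr_ge0// exprMn !normr_inner.
have [->|y0] := eqVneq y 0; first by rewrite !linear0r normr0 expr0n mulr0.
have N0 : 0 < '[y, y] by rewrite dnorm_gt0.
have := dnorm_ge0 inner ('[y, y] *: x - '[x, y] *: y).
rewrite linearBl/= !linearBr/= !innerZl !innerZr.
rewrite -(innerC y y) -(innerC y x) normCK -(innerC y x).
set N := '[y, y]; set c := '[x, y]; set c' := '[y, x].
have -> : N * (N * '[x, x]) - N * (c' * c) - (c * (N * c') - c * (c' * N)) =
  N * ('[x, x] * N - c * c') by ring.
by rewrite pmulr_rge0// subr_ge0.
Qed.

End InnerTheory.

Section RieszRepresentation.
Context {R : realType} {H : hilbertType R}.
Implicit Types (x y z w : H) (a : R[i]) (t e : R).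

Let nrm x : R := complex.Re `|x|.
Let rin x y : R := complex.Re '[x, y].

Let normE x : `|x| = (nrm x)%:C%C.
Proof. by rewrite RRe_real// ger0_real. Qed.

Let nrm_ge0 x : 0 <= nrm x.
Proof. by rewrite -ler0c -normE. Qed.

Let nrm_sqr x : nrm x ^+ 2 = rin x x.
Proof.
by rewrite /rin -normr_inner normE -rmorphXn.
Qed.

Let rinDl x y z : rin (x + y) z = rin x z + rin y z.
Proof. by rewrite /rin innerDl raddfD. Qed.

Let rinC x y : rin x y = rin y x.
Proof. by rewrite /rin innerC; case: (inner y x). Qed.

Let rinDr x y z : rin z (x + y) = rin z x + rin z y.
Proof. by rewrite rinC rinDl !(rinC z). Qed.

Let rinZl t x y : rin (t%:C%C *: x) y = t * rin x y.
Proof. by rewrite /rin innerZl; case: (inner x y) => a b /=; ring. Qed.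

Let rinZr t x y : rin x (t%:C%C *: y) = t * rin x y.
Proof. by rewrite rinC rinZl rinC. Qed.

Let rinBr x y z : rin z (x - y) = rin z x - rin z y.
Proof. by rewrite -scaleN1r -(rmorphN1 (real_complex R)) rinDr rinZr mulN1r. Qed.

Let quad x y t :
  nrm (x + t%:C%C *: y) ^+ 2 = nrm x ^+ 2 + 2 * t * rin y x + t ^+ 2 * nrm y ^+ 2.
Proof.
rewrite !nrm_sqr rinDl !rinDr !rinZl !rinZr (rinC x y); ring.
Qed.

Let CS x y : `|rin x y| <= nrm x * nrm y.
Proof.
rewrite -lecR rmorphM/= -!normE.
exact: le_trans (normc_ge_Re _) (norm_inner x y).
Qed.

Lemma riesz_representation (f : {scalar H}) (M : R) :
  (forall x, `|f x| <= M%:C%C * `|x|) -> exists z, forall x, f x = '[x, z].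
Proof.
move=> fM; pose g x : R := complex.Re (f x).
have gM x : `|g x| <= M * nrm x.
  have := le_trans (normc_ge_Re _) (fM x).
  by rewrite normE -rmorphM lecR.
have gDZ x t y : g (x + t%:C%C *: y) = g x + t * g y.
  rewrite /g linearD linearZ/= raddfD/=; case: (f y) => a b /=; ring.
pose J x := nrm x ^+ 2 - 2 * g x.
have J_ge x : - M ^+ 2 <= J x.
  have := ler_norm (g x); have := gM x; rewrite /J => h1 h2.
  have : 0 <= (nrm x - M) ^+ 2 by exact: sqr_ge0.
  rewrite sqrrB; lra.
have JDZ x y t : J (x + t%:C%C *: y) =
    J x + 2 * t * (rin y x - g y) + t ^+ 2 * nrm y ^+ 2.
  rewrite /J quad gDZ; ring.
pose d := inf (range J).
have hJ : has_inf (range J).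
  by split; [exists (J 0), 0|exists (- M ^+ 2) => _ [x _ <-]].
have dJ x : d <= J x by apply: (ge_inf hJ.2); exists x.
pose S e := [set x | J x < d + e].
have S0 e : 0 < e -> S e !=set0.
  by move=> e0; have [_ [x _ <-] xe] := inf_adherent e0 hJ; exists x.
have S_diam e x y : S e x -> S e y -> nrm (x - y) ^+ 2 < 4 * e.
  rewrite /S/= => xe ye.
  have -> : nrm (x - y) ^+ 2 =
      2 * J x + 2 * J y - 4 * J (x + (2^-1)%:C%C *: (y - x)).
    rewrite JDZ (rinC (y - x)).
    have -> : g (y - x) = g y - g x.
      by rewrite -scaleN1r -(rmorphN1 (real_complex R)) gDZ mulN1r.
    have -> : nrm (y - x) ^+ 2 = nrm (x - y) ^+ 2.
      by rewrite /nrm distrC.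
    have -> : nrm (x - y) ^+ 2 = nrm x ^+ 2 - 2 * rin y x + nrm y ^+ 2.
      have := quad x y (-1); rewrite rmorphN1 scaleN1r => ->; ring.
    rewrite /J !rinBr (rinC x y) -!nrm_sqr; by field.
  have := dJ (x + (2^-1)%:C%C *: (y - x)); lra.
pose F := filter_from [set e : R | 0 < e] S.
have FF : ProperFilter F.
  apply: filter_from_proper; last by move=> i; exact: S0.
  apply: filter_from_filter; first by exists 1; rewrite /= ltr01.
  move=> e1 e2 /= e10 e20; exists (Num.min e1 e2); first by rewrite /= lt_min e10.
  move=> u; rewrite /S/= => h.
  have : Num.min e1 e2 <= e1 /\ Num.min e1 e2 <= e2 by rewrite !ge_min !lexx orbT.
  by move=> [h1 h2]; split; lra.
have : cauchy F.
  apply: cauchy_exP => r r0.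
  have rE : r = (complex.Re r)%:C%C by rewrite RRe_real// gtr0_real.
  move: r0; rewrite rE ltcR; move: (complex.Re r) => s s0.
  have s20 : 0 < s ^+ 2 / 4 by rewrite divr_gt0// exprn_gt0.
  have [u Su] := S0 _ s20; exists u; exists (s ^+ 2 / 4) => // v Sv.
  rewrite -ball_normE /ball_/= normE ltcR -ltr_sqr ?nnegrE ?nrm_ge0 ?ltW//.
  have := S_diam _ _ _ Su Sv; lra.
move=> /cauchy_cvg /cvg_ex [z Fz]; exists z.
have key y : rin y z = g y.
  pose D := rin y z - g y; suff : D = 0 by rewrite /D; lra.
  have pos t : 0 <= 2 * t * D + t ^+ 2 * nrm y ^+ 2.
    rewrite leNgt; apply/negP; set c := (X in X < 0) => c0.
    pose K := 4 * (`|t| * nrm y + 1).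
    have K0 : 0 < K by rewrite mulr_gt0// ltr_wpDl// mulr_ge0.
    have : F (ball z (- c / K)%:C%C).
      by apply: Fz; apply: nbhsx_ballx; rewrite ltcR divr_gt0// oppr_gt0.
    move=> [e /= e0 Se].
    have me : 0 < Num.min e (- c / 4) by rewrite lt_min e0/= divr_gt0// oppr_gt0.
    have [x Sx] := S0 _ me.
    have [m1 m2] : Num.min e (- c / 4) <= e /\ Num.min e (- c / 4) <= - c / 4.
      by rewrite !ge_min !lexx orbT.
    have xe : S e x by rewrite /S/= in Sx *; lra.
    have := Se _ xe; rewrite -ball_normE /ball_/= normE ltcR => zx.
    have := dJ (x + t%:C%C *: y); rewrite JDZ.
    rewrite /S/= in Sx.
    have tx : t * (rin y x - rin y z) <= - c / 4.
      apply: le_trans (ler_norm _) _; rewrite normrM -rinBr.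
      have : nrm (x - z) < - c / K by rewrite /nrm distrC.
      rewrite ltr_pdivlMr// => xz.
      have h1 : `|t| * `|rin y (x - z)| <= `|t| * (nrm y * nrm (x - z)).
        by rewrite ler_wpM2l.
      have h2 := nrm_ge0 (x - z).
      rewrite /K in xz; nra.
    rewrite /c /D in tx m2 *; rewrite /c /D in c0; lra.
  have [//|D0] := eqVneq D 0.
  have N0 : 0 < nrm y ^+ 2 + 1 by rewrite ltr_wpDl// sqr_ge0.
  have := pos (- D / (nrm y ^+ 2 + 1)).
  have -> : 2 * (- D / (nrm y ^+ 2 + 1)) * D +
      (- D / (nrm y ^+ 2 + 1)) ^+ 2 * nrm y ^+ 2 =
      - (D / (nrm y ^+ 2 + 1)) ^+ 2 * (nrm y ^+ 2 + 2).
    by field; rewrite gt_eqF.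
  rewrite mulNr oppr_ge0 leNgt mulr_gt0//; first last.
    by rewrite ltr_wpDl// sqr_ge0.
  by rewrite exprn_even_gt0//= mulf_neq0// invr_neq0 ?gt_eqF.
move=> x; have := key x; have := key ('i%C *: x).
rewrite /rin /g innerZl linearZ.
case: (f x) (inner x z) => [a b] [p q] /= h1 h2.
have -> : a = p by lra.
by have -> : b = q by lra.
Qed.

End RieszRepresentation.
Section Adjoint.
Context {R : realType} {H : hilbertType R}.
Implicit Types (T : boundedOp H) (x y : H).

Definition adjoint T y : H := xget 0 [set z | forall x, '[T x, y] = '[x, z]].

(* The default value 0 in the definition of adjoint is never taken. *)
Lemma adjointP T x y : '[T x, y] = '[x, adjoint T y].
Proof.
suff /xgetPex : exists z, forall x, '[T x, y] = '[x, z] by exact.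
pose f : H -> R[i] := fun x => '[T x, y].
have f_lin : scalar f.
  by move=> a u v; rewrite /f linearP innerDl innerZl.
pose fL := GRing.isLinear.Build _ _ _ _ f f_lin.
pose F : {scalar H} := HB.pack f fL.
have [M TM] := @op_bounded _ _ T.
apply: (riesz_representation (f := F) (M := M * complex.Re `|y|)) => u.
have yE : `|y| = (complex.Re `|y|)%:C%C by rewrite RRe_real// ger0_real.
rewrite rmorphM/= -yE mulrAC; apply: le_trans (norm_inner _ _) _.
by rewrite ler_wpM2r.
Qed.

Lemma adjoint_unique T (S : H -> H) :
  (forall x y, '[T x, y] = '[x, S y]) -> S =1 adjoint T.
Proof. by move=> TS y; apply: inner_ext => x; rewrite -adjointP TS. Qed.

Fact adjoint_is_linear T : linear (adjoint T).
Proof.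
move=> a x y; apply: inner_ext => w.
by rewrite innerDr innerZr -!adjointP innerDr innerZr.
Qed.

HB.instance Definition _ T :=
  GRing.isLinear.Build R[i] H H *:%R (adjoint T) (adjoint_is_linear T).

Fact adjoint_bounded T :
  exists M : R, forall x, `|adjoint T x| <= M%:C%C * `|x|.
Proof.
have [M TM] := @op_bounded _ _ T; exists M => x.
have [->|x0] := eqVneq (adjoint T x) 0.
  rewrite normr0; have [->|x0] := eqVneq x 0; first by rewrite normr0 mulr0.
  by rewrite (le_trans _ (TM x)).
rewrite -(ler_pM2r (x := `|adjoint T x|)) ?normr_gt0//.
rewrite -expr2 normr_inner -adjointP -[leLHS]ger0_norm; last first.
  by rewrite adjointP.
apply: le_trans (norm_inner _ _) _.
by rewrite mulrAC ler_wpM2r.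
Qed.

HB.instance Definition _ T :=
  isBoundedOp.Build R H (adjoint T) (adjoint_bounded T).

End Adjoint.

Definition self_adjoint (R : realType) (H : hilbertType R) (T : boundedOp H) :=
  adjoint T =1 T.

Definition normal_op (R : realType) (H : hilbertType R) (T : boundedOp H) :=
  T \o adjoint T =1 adjoint T \o T.

Definition spectrum (R : realType) (H : hilbertType R) (T : boundedOp H) :
    set R[i] :=
  [set z | ~ exists S : boundedOp H,
    (forall x, S (T x - z *: x) = x) /\ (forall x, T (S x) - z *: S x = x)].

(* Main.v *)
(* Normality means that A and B commute. If B <> 0, then B has a nonzero real
   approximate eigenvalue b, and since A commutes with B there is a real a such
   that A - a and B - b are small on a common unit vector. Then T - (a + ib) is
   not bounded below, so the nonreal number a + ib lies in the spectrum of T. *)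
Require Import Defs.
From mathcomp Require Import all_boot all_order all_algebra.
From mathcomp Require Import complex.
From mathcomp Require Import classical_sets reals.
From mathcomp Require Import ring lra boolp normedtype.

Import Order.TTheory GRing.Theory Num.Theory.

Local Open Scope classical_set_scope.
Local Open Scope ring_scope.

(** * Real-valued norm and inner product *)

Section RealInner.
Context {R : realType} {H : hilbertType R}.
Implicit Types (x y z : H) (t : R).

(** Real parts place norms and inner products in the ordered field [R], where [lra] and [nra] apply;
    by [rnormE] the norm loses nothing. *)
Definition rnorm x : R := complex.Re `|x|.
Definition rinner x y : R := complex.Re (inner x y).

Lemma rnormE x : `|x| = (rnorm x)%:C%C.
Proof. by rewrite RRe_real// ger0_real. Qed.

Lemma rnorm_ge0 x : 0 <= rnorm x.
Proof. by rewrite -ler0c -rnormE. Qed.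

Lemma rnorm_gt0 x : x != 0 -> 0 < rnorm x.
Proof. by rewrite -ltcR -rnormE normr_gt0. Qed.

Lemma rnorm_sqr x : rnorm x ^+ 2 = rinner x x.
Proof. by rewrite /rinner -normr_inner rnormE -rmorphXn. Qed.

Lemma rnormD x y : rnorm (x + y) <= rnorm x + rnorm y.
Proof. by rewrite -lecR rmorphD/= -!rnormE ler_normD. Qed.

Lemma rnormN x : rnorm (- x) = rnorm x.
Proof. by rewrite /rnorm normrN. Qed.

Lemma rnormB x y : rnorm (x - y) <= rnorm x + rnorm y.
Proof. by rewrite -(rnormN y) rnormD. Qed.

Lemma rnormZ (a : R[i]) x : rnorm (a *: x) = complex.Re `|a| * rnorm x.
Proof.
rewrite /rnorm normrZ rnormE -[X in X * _](RRe_real (ger0_real _))//.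
by rewrite -rmorphM.
Qed.

Lemma rnormZr t x : rnorm (t%:C%C *: x) = `|t| * rnorm x.
Proof. by rewrite rnormZ normc_def/= expr0n addr0 sqrtr_sqr. Qed.

Lemma rinnerDl x y z : rinner (x + y) z = rinner x z + rinner y z.
Proof. by rewrite /rinner innerDl raddfD. Qed.

Lemma rinnerC x y : rinner x y = rinner y x.
Proof. by rewrite /rinner innerC; case: (inner y x). Qed.

Lemma rinnerDr x y z : rinner z (x + y) = rinner z x + rinner z y.
Proof. by rewrite rinnerC rinnerDl !(rinnerC z). Qed.

Lemma rinnerZl t x y : rinner (t%:C%C *: x) y = t * rinner x y.
Proof. by rewrite /rinner innerZl; case: (inner x y) => a b /=; ring. Qed.

Lemma rinnerNl x y : rinner (- x) y = - rinner x y.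
Proof. by rewrite -scaleN1r -(rmorphN1 (real_complex R)) rinnerZl mulN1r. Qed.

Lemma rinner_le x y : rinner x y <= rnorm x * rnorm y.
Proof.
apply: le_trans (ler_norm _) _; rewrite -lecR rmorphM/= -!rnormE.
exact: le_trans (normc_ge_Re _) (norm_inner x y).
Qed.

Lemma bounded_rnorm (T : boundedOp H) :
  exists2 K : R, 0 < K & forall x, rnorm (T x) <= K * rnorm x.
Proof.
have [M TM] := @op_bounded _ _ T; exists (`|M| + 1) => [|x].
  by rewrite ltr_wpDl.
have := TM x; rewrite !rnormE -rmorphM lecR => /le_trans; apply.
rewrite ler_wpM2r ?rnorm_ge0//.
by have := ler_norm M; lra.
Qed.

(** * Symmetric operators and their approximate eigenvalues *)

Definition symmetric_op (A : H -> H) :=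
  forall x y, rinner (A x) y = rinner x (A y).

Lemma self_adjoint_inner (A : boundedOp H) : self_adjoint A ->
  forall x y, inner (A x) y = inner x (A y).
Proof. by move=> sA x y; rewrite adjointP sA. Qed.

Lemma self_adjoint_symmetric (A : boundedOp H) : self_adjoint A -> symmetric_op A.
Proof. by move=> sA x y; rewrite /rinner self_adjoint_inner. Qed.

(** Expanding the form at [x + A x], symmetry leaves only twice the squared norm of [A x]. *)
Lemma symmetric_form_eq0 (A : {linear H -> H}) : symmetric_op A ->
  (forall x, rinner (A x) x = 0) -> forall x, A x = 0.
Proof.
move=> sA A0 x; have := A0 (x + A x).
rewrite linearD rinnerDl !rinnerDr !A0 (sA (A x)) -rnorm_sqr => h.
apply/eqP; rewrite -normr_eq0 rnormE; apply/eqP; congr (_%:C)%C.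
apply/eqP; rewrite -sqrf_eq0; apply/eqP; lra.
Qed.

(* [M] is the supremum of the quadratic form of [A] over the approximate null
   vectors of [C]. Moving an almost maximizing [x] in the direction
   [(M + h) x - A x], which stays approximately in the kernel of [C], would
   exceed the supremum unless [A x - M x] is small. *)
Lemma joint_approx_eigenvalue (A C : {linear H -> H}) (K t : R) :
  symmetric_op A -> (forall x, rnorm (A x) <= K * rnorm x) ->
  (forall x, C (A x) = A (C x)) ->
  (forall e, 0 < e -> exists x, [/\ x != 0, rnorm (C x) <= e * rnorm x &
    t * rnorm x ^+ 2 <= rinner (A x) x]) ->
  exists2 M, t <= M & forall e, 0 < e -> exists x, [/\ x != 0,
    rnorm (C x) <= e * rnorm x & rnorm (A x - M%:C%C *: x) <= e * rnorm x].
Proof.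
move=> sA AK CA Et.
pose E := [set u : R | forall e, 0 < e -> exists x, [/\ x != 0,
  rnorm (C x) <= e * rnorm x & u * rnorm x ^+ 2 <= rinner (A x) x]].
have ubE : ubound E K.
  move=> u /(_ 1 ltr01) [x [x0 _ ux]].
  rewrite -(ler_pM2r (x := rnorm x ^+ 2)) ?exprn_gt0 ?rnorm_gt0//.
  apply: le_trans ux _; apply: le_trans (rinner_le _ _) _.
  by rewrite expr2 mulrA ler_wpM2r ?rnorm_ge0.
have supE : has_sup E by split; [exists t | exists K].
pose M := sup E.
exists M => [|e e0]; first exact: ub_le_sup supE.2 _ Et.
pose L := `|M| + `|K| + 1.
have L0 : 0 < L by have := normr_ge0 M; have := normr_ge0 K; rewrite /L; lra.
(* The bound 1 makes [L] bound [M + h - A]; [e / 2] controls the term [h x] at the end;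
   [e ^+ 2 / (12 * L)] turns the estimate [DxL] into [DxE]. *)
pose h := Num.min 1 (Num.min (e / 2) (e ^+ 2 / (12 * L))).
have h0 : 0 < h.
  by rewrite !lt_min ltr01 !divr_gt0 ?exprn_gt0// mulr_gt0.
have h1 : h <= 1 by rewrite !ge_min lexx.
have he : h <= e / 2 by rewrite !ge_min lexx orbT.
have hL : h * (12 * L) <= e ^+ 2.
  by rewrite -ler_pdivlMr ?mulr_gt0// !ge_min lexx !orbT.
(* As [M + h] exceeds the supremum, it lies outside [E], so it fails at one definite tolerance
   [eps]. *)
have [eps eps0 Hub] : exists2 eps, 0 < eps & forall x,
    rnorm (C x) <= eps * rnorm x -> rinner (A x) x <= (M + h) * rnorm x ^+ 2.
  have : ~ E (M + h).
    by move=> /(ub_le_sup supE.2); rewrite -/M; lra.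
  move=> /existsNP [eps /not_implyP [eps0 nx]]; exists eps => // x Cx.
  have [->|x0] := eqVneq x 0.
    rewrite linear0 rnorm_sqr /rinner linear0l/=; lra.
  by rewrite leNgt; apply/negP => /ltW lt; apply: nx; exists x.
have [u Eu Mu] := sup_adherent h0 supE.
(* Passing from [x] to [y] below multiplies the norm of [C x] by at most 3/2, and the norm of [x] is
   at most twice that of [y]; hence the factor 3. *)
pose ee := Num.min (eps / 3) e.
have ee0 : 0 < ee by rewrite lt_min e0 divr_gt0.
have [x [x0 Cx ux]] := Eu _ ee0.
have n0 := rnorm_gt0 _ x0.
exists x; split=> //.
  by apply: le_trans Cx _; rewrite ler_wpM2r ?rnorm_ge0// ge_min lexx orbT.
pose D y := (M + h)%:C%C *: y - A y.
have DL y : rnorm (D y) <= L * rnorm y.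
  apply: le_trans (rnormB _ _) _; rewrite rnormZr.
  have := AK y; have := rnorm_ge0 y; have := ler_norm K; have := ler_normD M h.
  rewrite (ger0_norm (ltW h0)) /L; nra.
have CD y : C (D y) = D (C y) by rewrite /D linearB linearZ/= CA.
(* With this step length, [s D x] has at most half the norm of [x], so [y] is nonzero and comparable
   to [x]. *)
pose s := (2 * L)^-1.
have sL : s * L = 2^-1 by rewrite /s; field; rewrite gt_eqF.
have s0 : 0 < s by rewrite invr_gt0 mulr_gt0.
pose y := x - s%:C%C *: D x.
have ny : rnorm x <= 2 * rnorm y.
  have : rnorm x <= rnorm y + rnorm (s%:C%C *: D x).
    by rewrite -{1}(subrK (s%:C%C *: D x) x) rnormD.
  rewrite rnormZr gtr0_norm//; have := DL x; nra.
have nCy : rnorm (C y) <= eps * rnorm y.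
  rewrite /y linearB linearZ/= CD; apply: le_trans (rnormB _ _) _.
  rewrite rnormZr gtr0_norm//; have := DL (C x).
  have : ee <= eps / 3 by rewrite ge_min lexx.
  have := rnorm_ge0 (C x).
  rewrite -/y; nra.
have DE z w : rinner (D z) w = (M + h) * rinner z w - rinner (A z) w.
  by rewrite /D rinnerDl rinnerNl rinnerZl.
have sD z w : rinner (D z) w = rinner z (D w).
  by rewrite (rinnerC z) !DE sA (rinnerC w) (rinnerC (A w)).
have Dy : 0 <= rinner (D y) y.
  by have := Hub _ nCy; rewrite DE -rnorm_sqr; lra.
have Dx : rinner (D x) x <= 2 * h * rnorm x ^+ 2.
  have := ler_wpM2r (sqr_ge0 (rnorm x)) (ltW Mu).
  by rewrite DE -rnorm_sqr -/M; lra.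
have DDx : rinner (D (D x)) (D x) <= L * rnorm (D x) ^+ 2.
  apply: le_trans (rinner_le _ _) _.
  by rewrite expr2 mulrA ler_wpM2r ?rnorm_ge0.
have DyE : rinner (D y) y = rinner (D x) x - 2 * s * rnorm (D x) ^+ 2
    + s ^+ 2 * rinner (D (D x)) (D x).
  have yE w : rinner y w = rinner x w - s * rinner (D x) w.
    by rewrite /y rinnerDl rinnerNl rinnerZl.
  rewrite rnorm_sqr sD yE -!sD (rinnerC (D x) y) (rinnerC (D (D x)) y) !yE.
  by rewrite -!sD; ring.
(* The last term of [DyE] is at most a quarter of the middle one, so [Dy] and [Dx] bound
   [3 / 2 * s * rnorm (D x) ^+ 2] by [2 * h * rnorm x ^+ 2]. Dividing by [s] gives the constant 8/3,
   rounded up to 3. *)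
have DxL : rnorm (D x) ^+ 2 <= 3 * L * h * rnorm x ^+ 2.
  have sDDx : s ^+ 2 * rinner (D (D x)) (D x) <= s / 2 * rnorm (D x) ^+ 2.
    have -> : s / 2 = s ^+ 2 * L by rewrite expr2 -mulrA sL.
    by rewrite -mulrA ler_wpM2l ?sqr_ge0.
  have : s * rnorm (D x) ^+ 2 <= 4 / 3 * h * rnorm x ^+ 2.
    by rewrite DyE in Dy; lra.
  have -> : s = 1 / (2 * L) by rewrite /s mul1r.
  rewrite mulrAC ler_pdivrMr ?mulr_gt0//.
  have : 0 <= h * rnorm x ^+ 2 * L.
    by rewrite !mulr_ge0 ?sqr_ge0 ?ltW.
  by lra.
have DxE : rnorm (D x) <= e / 2 * rnorm x.
  rewrite -ler_sqr ?nnegrE ?mulr_ge0 ?rnorm_ge0 ?divr_ge0 ?(ltW e0) ?invr_ge0//.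
  apply: le_trans DxL _; rewrite exprMn ler_wpM2r ?sqr_ge0//.
  by rewrite expr_div_n; lra.
rewrite (_ : A x - _ = h%:C%C *: x - D x); last first.
  by rewrite /D rmorphD scalerDl opprB addrCA; congr (_ + _);
    rewrite opprD addrCA subrr addr0.
apply: le_trans (rnormB _ _) _; rewrite rnormZr gtr0_norm//.
have := ler_wpM2r (rnorm_ge0 x) he; lra.
Qed.

(** With the zero operator as [C], every vector is an approximate null vector; the Rayleigh quotient
    of [v] serves as the positive lower bound [t]. *)
Lemma approx_eigenvalue_gt0 (A : {linear H -> H}) (K : R) (v : H) :
  symmetric_op A -> (forall x, rnorm (A x) <= K * rnorm x) ->
  0 < rinner (A v) v ->
  exists2 M, 0 < M & forall e, 0 < e -> exists2 x, x != 0 &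
    rnorm (A x - M%:C%C *: x) <= e * rnorm x.
Proof.
move=> sA AK Av.
have v0 : 0 < rnorm v ^+ 2.
  rewrite exprn_gt0// rnorm_gt0//; apply: contraTneq Av => ->.
  by rewrite linear0 /rinner linear0l ltxx.
have [||M tM Me] := joint_approx_eigenvalue A (\0 : {linear H -> H}) K
    (rinner (A v) v / rnorm v ^+ 2) sA AK.
- by move=> x /=; rewrite linear0.
- move=> e e0; exists v; split; first by apply: contraTneq v0 => ->;
    rewrite rnorm_sqr /rinner linear0l ltxx.
  + by rewrite /= /rnorm normr0 mulr_ge0 ?(ltW e0)// rnorm_ge0.
  + by rewrite divfK ?gt_eqF.
exists M; first by rewrite (lt_le_trans _ tM)// divr_gt0.
by move=> e /Me [x [x0 _ xe]]; exists x.
Qed.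

(** If the form is negative at [v], the positive case applies to [- A]. *)
Lemma approx_eigenvalue_neq0 (A : {linear H -> H}) (K : R) (v : H) :
  symmetric_op A -> (forall x, rnorm (A x) <= K * rnorm x) ->
  rinner (A v) v != 0 ->
  exists2 M, M != 0 & forall e, 0 < e -> exists2 x, x != 0 &
    rnorm (A x - M%:C%C *: x) <= e * rnorm x.
Proof.
move=> sA AK; rewrite neq_lt => /orP[Av|Av]; last first.
  have [M M0 Me] := approx_eigenvalue_gt0 A K v sA AK Av.
  by exists M => //; rewrite gt_eqF.
have [|||M M0 Me] :=
    approx_eigenvalue_gt0 (\- A : {linear H -> H}) K v _ _ _.
- move=> x y /=.
  by rewrite rinnerNl (rinnerC _ (- _)) rinnerNl (rinnerC _ x) sA.
- by move=> x /=; rewrite rnormN.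
- by rewrite /= rinnerNl oppr_gt0.
exists (- M); first by rewrite oppr_eq0 gt_eqF.
move=> e /Me [x x0 xe]; exists x => //.
by rewrite -rnormN opprB addrC rmorphN scaleNr.
Qed.

(** * Cartesian decomposition, commutation and spectrum *)

Section CartesianDecomposition.
Context (T A B : boundedOp H).
Context (sA : self_adjoint A) (sB : self_adjoint B).
Context (TE : forall x, T x = A x + 'i *: B x).

Lemma adjoint_cartesian x : adjoint T x = A x - 'i *: B x.
Proof.
apply/esym; move: x; apply: adjoint_unique => x y.
rewrite TE innerDl innerZl !self_adjoint_inner//.
by rewrite linearBr/= innerZr conjCi mulNr opprK.
Qed.

(** The commutator of [T] and its adjoint [A - iB] equals [2i (BA - AB)]. *)
Lemma normal_cartesian_commute : normal_op T -> forall x, B (A x) = A (B x).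
Proof.
move=> nT x; apply: inner_ext => w; apply/eqP; rewrite -subr_eq0.
have /(congr1 (inner w)) := nT x.
rewrite /= adjoint_cartesian TE adjoint_cartesian TE.
rewrite !(linearB A, linearB B, linearD A, linearD B, linearZZ A, linearZZ B).
have innerNr y : inner w (- y) = - inner w y by rewrite linearNr.
rewrite !(innerDr, innerZr, innerNr) !conjCi.
set p := inner w (A (A x)); set q := inner w (A (B x)).
set r := inner w (B (A x)); set s := inner w (B (B x)) => h.
have : 2 * 'i * (r - q) = 0 :> R[i].
  move/eqP: h; rewrite -subr_eq0 => /eqP h; rewrite -[RHS]oppr0 -[in RHS]h.
  by ring.
by move/eqP; rewrite !mulf_eq0 pnatr_eq0 (negPf (neq0Ci _)).
Qed.

Lemma cartesian_spectrum (a b : R) :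
  (forall e, 0 < e -> exists x, [/\ x != 0,
    rnorm (A x - a%:C%C *: x) <= e * rnorm x &
    rnorm (B x - b%:C%C *: x) <= e * rnorm x]) ->
  spectrum T (a%:C + 'i * b%:C)%C.
Proof.
move=> ab [S [SK _]]; have [K K0 SB] := bounded_rnorm S.
(* [T - (a + ib)] has size at most [2 e] relative to [x]; with [e = 1 / (4K)], an inverse bounded by
   [K] would shrink the norm of [x] to half of itself. *)
have e0 : 0 < (4 * K)^-1 by rewrite invr_gt0 mulr_gt0.
have [x [x0 xa xb]] := ab _ e0; have := rnorm_gt0 x x0.
have := SB (T x - (a%:C + 'i * b%:C)%C *: x); rewrite SK.
have -> : T x - (a%:C + 'i * b%:C)%C *: x =
    (A x - a%:C%C *: x) + 'i *: (B x - b%:C%C *: x).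
  by rewrite TE scalerDl scalerBr scalerA opprD addrACA.
move=> h; have := rnormD (A x - a%:C%C *: x) ('i *: (B x - b%:C%C *: x)).
rewrite rnormZ normCi/= mul1r => h1 n0.
suff : rnorm x <= 1 / 2 * rnorm x by lra.
apply: le_trans h _.
have -> : 1 / 2 * rnorm x = K * (2 * (4 * K)^-1 * rnorm x).
  by field; rewrite gt_eqF.
by rewrite ler_wpM2l ?(ltW K0)//; lra.
Qed.

End CartesianDecomposition.
End RealInner.

(** * From real spectrum to self-adjointness *)

Theorem proposition2p18 (R : realType) (H : hilbertType R)
    (T A B : boundedOp H)
    (hT : normal_op T)
    (hA : self_adjoint A) (hB : self_adjoint B)
    (hTAB : forall x : H, T x = A x + 'i *: B x)
    (hspec : spectrum T `<=` [set z : R[i] | z \is Num.real]) :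
  self_adjoint T.
Proof.
suff B0 x : B x = 0.
  by move=> x; rewrite (adjoint_cartesian T A B)// hTAB B0 scaler0 subr0 addr0.
move: x; apply: symmetric_form_eq0; first exact: self_adjoint_symmetric.
move=> v; apply/eqP; apply: contrapT => /negP Bv.
have [KA KA0 AK] := bounded_rnorm A; have [KB KB0 BK] := bounded_rnorm B.
have [b b0 Bb] := approx_eigenvalue_neq0 B KB v
  (self_adjoint_symmetric B hB) BK Bv.
(* Approximate null vectors of [C] are approximate eigenvectors of [B] at [b]. The form of [A] is
   bounded below by [- KA], which serves as [t]. *)
pose C : {linear H -> H} := B \- b%:C%C \*: idfun.
have [||a _ ab] := joint_approx_eigenvalue A C KA (- KA)
    (self_adjoint_symmetric A hA) AK.
- move=> x /=; rewrite (linearB A) (linearZZ A).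
  by rewrite (normal_cartesian_commute T A B).
- move=> e /Bb [x x0 xe]; exists x; split=> //.
  rewrite mulNr lerNl -rinnerNl; apply: le_trans (rinner_le _ _) _.
  by rewrite rnormN expr2 mulrA; apply: ler_wpM2r; [exact: rnorm_ge0|exact: AK].
have /hspec : spectrum T (a%:C + 'i * b%:C)%C.
  apply: (cartesian_spectrum T A B) => // e /ab [x [x0 xb xa]].
  by exists x.
(* The imaginary part of this spectral value is [b], which is nonzero. *)
rewrite /= realE !lecE/= !mul0r !mul1r !add0r [0 == b]eq_sym.
by rewrite (negPf b0).
Qed.
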